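(* Let $(M,L)$ and $(M,\tilde L)$ be two Finsler manifolds with Finsler metrics $g$ and $\tilde g$. Then $g$ and $\tilde g$ are conformal if, and only if, $$\frac{d_J\tilde L}{\tilde L}=\frac{d_JL}{L}.$$
   Context: $M$ is a smooth manifold; $\mathcal TM\subset TM$ is the bundle of nonzero tangent vectors; $J$ is the natural almost tangent structure on $TM$ (locally $J(\partial/\partial x^i)=\partial/\partial y^i$, $J(\partial/\partial y^i)=0$), and $d_Jf(X)=df(JX)$ for a function $f$; $\mathcal C=y^i\partial/\partial y^i$. A Finsler manifold $(M,L)$: $L:TM\to\mathbb R$, $L\ge0$, $L(0)=0$, $L$ is $C^\infty$ on $\mathcal TM$, $C^1$ on $TM$, $\mathcal C\cdot L=L$, and the form $g$ on the pullback bundle $\pi^{-1}(TM)\to\mathcal TM$ with components $g_{ij}=\frac12\frac{\partial^2L^2}{\partial y^i\partial y^j}$ is positive definite (the Finsler metric). The metrics $g,\tilde g$ are conformal if there is a positive differentiable function $\psi(x,y)$ on $TM$ with $\tilde g(\overline X,\overline Y)=\psi(x,y)g(\overline X,\overline Y)$ for all sections $\overline X,\overline Y$ of $\pi^{-1}(TM)$ (equivalently $\tilde L^2=\psi L^2$; such $\psi$ then depends on $x$ only). The equality in the claim is over $\mathcal TM$.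
   Formalization: The condition ''L is C^1 on TM'' contradicts homogeneity and positive definiteness in positive dimension; it is replaced by ''L is C^1 on TM, or dim M ≥ 2 and L^2 is C^1 on TM'' (in dimension one the claim fails for non-reversible L). *)

(* Defs.v *)
From HB Require Import structures.
From mathcomp Require Import all_boot all_order all_algebra.
From mathcomp Require Import all_classical all_reals all_analysis.
Set Implicit Arguments.
Unset Strict Implicit.
Unset Printing Implicit Defensive.
Import Order.TTheory GRing.Theory Num.Theory.
Import numFieldNormedType.Exports.
Local Open Scope classical_set_scope.
Local Open Scope ring_scope.

Section Calculus.
Variable R : realType.

(* C^k regularity on an open set D; the directional form of the recursion is
   the usual notion because V is finite dimensional wherever this is used. *)
Fixpoint Ck (V W : normedModType R) (k : nat) (D : set V) (f : V -> W) : Prop :=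
  match k with
  | 0%N => forall x, D x -> {for x, continuous f}
  | k'.+1 => (forall x, D x -> differentiable f x) /\
             forall v, Ck k' D (fun x => 'd f x v)
  end.

Lemma near_eq_is_diff (V W : normedModType R) (f g : V -> W) (x : V) :
  (\forall z \near x, f z = g z) -> differentiable f x ->
  differentiable g x /\ 'd g x = 'd f x :> (V -> W).
Proof.
move=> fg df.
have h : continuous (0 : V -> W) /\
    (g - f) \o shift x = cst ((g - f) x) + (0 : V -> W) +o_ 0 id.
  split; first by move=> y; exact: cst_continuous.
  apply/eqaddoE; apply/eqaddoP => e e0 /=.
  have fgx : g x = f x by rewrite (nbhs_singleton fg).
  have gx : \forall z \near (0 : V), f (z + x) = g (z + x).
    have zx : (fun z : V => z + x) @ (0 : V) --> x.
      have := @cvgD _ _ _ _ _ (fun z : V => z) (cst x) 0 x (@cvg_id _ _) (cvg_cst _).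
      by rewrite add0r; apply.
    exact: zx _ fg.
  apply: filterS gx => z fgz.
  by rewrite !fctE /= fgz fgx !subrr addr0 subr0 normr0 mulr_ge0 // ltW.
have d0 : 'd (g - f) x = (0 : V -> W) :> (V -> W).
  by apply: diff_unique; [exact: h.1|exact: h.2].
have dgf : differentiable (g - f) x.
  by apply/diff_locallyP; rewrite d0; exact: h.
have gE : g = f + (g - f) by rewrite addrC subrK.
split; first by rewrite gE; exact: differentiableD.
apply/funext => z.
have d0z : 'd (g - f) x z = 0 by exact: (congr1 (@^~ z) d0).
have E : 'd (f + (g - f)) x z = 'd f x z + 'd (g - f) x z.
  exact: (congr1 (@^~ z) (diffD df dgf)).
by rewrite {1}gE E d0z addr0.
Qed.

Lemma is_diff_fst (V W : normedModType R) (z : V * W) :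
  differentiable (fst : V * W -> V) z /\ forall w, 'd (fst : V * W -> V) z w = w.1.
Proof.
have c : continuous (fst : V * W -> V) by move=> w; exact: cvg_fst.
by split=> [|w]; [exact: linear_differentiable|rewrite (diff_lin _ c)].
Qed.

Lemma is_diff_snd (V W : normedModType R) (z : V * W) :
  differentiable (snd : V * W -> W) z /\ forall w, 'd (snd : V * W -> W) z w = w.2.
Proof.
have c : continuous (snd : V * W -> W) by move=> w; exact: cvg_snd.
by split=> [|w]; [exact: linear_differentiable|rewrite (diff_lin _ c)].
Qed.

Lemma diff_compE (U V W : normedModType R) (f : U -> V) (g : V -> W) x v :
  differentiable f x -> differentiable g (f x) ->
  'd (g \o f) x v = 'd g (f x) ('d f x v).
Proof. by move=> df dg; exact: (congr1 (@^~ v) (diff_comp df dg)). Qed.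

(* The tangent map (x, y) |-> (t x, t'(x) y) of a twice differentiable map. *)
Lemma is_diff_tangent_map n (t : 'rV[R]_n -> 'rV[R]_n) (x y : 'rV[R]_n)
    (G := fun z : 'rV[R]_n * 'rV[R]_n => (t z.1, 'd t (z.1 : 'rV[R]_n) z.2)) :
  differentiable t x ->
  (forall v, differentiable (fun x' => 'd t x' v) x) ->
  [/\ differentiable G (x, y),
      forall z, ('d G (x, y) z).1 = 'd t x z.1 &
      forall v, 'd G (x, y) (0, v) = (0, 'd t x v)].
Proof.
move=> dt ddt.
have [dfst fstE] := is_diff_fst (x, y).
have [dsnd _] := is_diff_snd (x, y).
have dG1 : differentiable (t \o fst : 'rV[R]_n * 'rV[R]_n -> 'rV[R]_n) (x, y).
  exact: differentiable_comp.
pose H (z : 'rV[R]_n * 'rV[R]_n) := 'd t (z.1 : 'rV[R]_n) z.2.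
pose T (k l : 'I_n) (z : 'rV[R]_n * 'rV[R]_n) : 'rV[R]_n :=
  (z.2 0 k * ('d t (z.1 : 'rV[R]_n) (delta_mx 0 k) : 'rV[R]_n) 0 l)
    *: (delta_mx 0 l : 'rV[R]_n).
have HE : H = \sum_(k < n) \sum_(l < n) T k l.
  apply/funext => z; rewrite fct_sumE /H {1}(row_sum_delta z.2) linear_sum.
  apply: eq_bigr => k _; rewrite fct_sumE linearZ /=.
  rewrite {1}(row_sum_delta ('d t (z.1 : 'rV[R]_n) (delta_mx 0 k))) scaler_sumr.
  by apply: eq_bigr => l _; rewrite scalerA.
have dH : differentiable H (x, y).
  rewrite HE; apply: differentiable_sum => k; apply: differentiable_sum => l.
  have cd (f : 'rV[R]_n * 'rV[R]_n -> 'rV[R]_n) i : differentiable f (x, y) ->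
      differentiable (fun z => f z 0 i : R) (x, y).
    by move=> df; exact: (differentiable_comp df (differentiable_coord (f (x, y)) 0 i)).
  have dk : differentiable (fun z : 'rV[R]_n * 'rV[R]_n =>
      'd t (z.1 : 'rV[R]_n) (delta_mx 0 k : 'rV[R]_n)) (x, y).
    exact: (@differentiable_comp _ _ _ _ fst
      (fun x' : 'rV[R]_n => 'd t x' (delta_mx 0 k : 'rV[R]_n)) (x, y) dfst (ddt _)).
  have c1 := cd _ k dsnd.
  have c2 := cd _ l dk.
  have c3 := differentiableM c1 c2.
  have c4 := differentiableZl (delta_mx 0 l : 'rV[R]_n) c3.
  exact: c4.
have dG : differentiable G (x, y) by exact: differentiable_pair.
have GE z : 'd G (x, y) z = ('d (t \o fst) (x, y) z, 'd H (x, y) z).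
  exact: (congr1 (@^~ z) (diff_pair dG1 dH)).
have G1 z : 'd (t \o fst) (x, y) z = 'd t x z.1.
  by rewrite (diff_compE _ dfst dt) fstE.
split=> // [z|v]; first by rewrite GE /= G1.
have G10 : 'd (t \o fst) (x, y) (0, v) = 0 by rewrite (G1 (0, v)) /= linear0.
pose inc (v : 'rV[R]_n) := (x, v).
have dcx : differentiable (fun=> x) y by exact: differentiable_cst.
have did : differentiable id y by exact: ex_diff.
have dinc : differentiable inc y by exact: differentiable_pair.
have incE : 'd inc y v = (0, v).
  apply: (eq_trans (congr1 (@^~ v) (diff_pair dcx did))).
  have e1 : 'd (fun=> x) y v = 0 by exact: (congr1 (@^~ v) (diff_cst x y)).
  have e2 : 'd id y v = v by rewrite diff_val.
  exact: (f_equal2 pair e1 e2).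
have H2 : 'd H (x, y) (0, v) = 'd t x v.
  rewrite -incE.
  apply: (eq_trans (esym (diff_compE v dinc dH))).
  exact: (congr1 (@^~ v) (diff_lin y (diff_continuous dt))).
exact: (eq_trans (GE (0, v)) (f_equal2 pair G10 H2)).
Qed.

End Calculus.

(* A covering family of charts of a set T in the model space E.  [param i] is
   the inverse of the chart [coord i], with junk values outside its image;
   [chart_at] selects a chart around each point. *)
Record atlas (R : realType) (E : normedModType R) (T : Type) := Atlas {
  idx : Type;
  dom : idx -> set T;
  coord : idx -> T -> E;
  param : idx -> E -> T;
  chart_at : T -> idx
}.
Arguments chart_at {R E T} a.

Section Atlas.
Variables (R : realType) (E : normedModType R) (T : Type) (A : atlas E T).

Definition trans (i j : idx A) : E -> E := coord j \o param i.

(* A tangent vector at p is the family of its components in the charts around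
   p, related by the differentials of the coordinate changes.  The components
   in the other charts are irrelevant and normalized to 0. *)
Record tvec (p : T) := TVec {
  comp :> idx A -> E;
  comp_trans : forall i j, dom i p -> dom j p ->
    comp j = 'd (trans i j) (coord i p) (comp i);
  comp_out : forall i, ~ dom i p -> comp i = 0
}.

Definition Ck_on (k : nat) (D : set T) (f : T -> R) :=
  forall i : idx A, Ck k (coord i @` (dom i `&` D)) (f \o param i).

Definition differentiable_on (D : set T) (f : T -> R) :=
  forall (i : idx A) p, dom i p -> D p ->
    differentiable (f \o param i) (coord i p).

(* df(X), computed in the chart selected at p; see [tdiffE] for the
   independence of this choice. *)
Definition tdiff (f : T -> R) (p : T) (X : tvec p) : R :=
  let c := chart_at A p in 'd (f \o param c) (coord c p) (X c).

Lemma tvec_ext (p : T) (X Y : tvec p) (i : idx A) :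
  dom i p -> X i = Y i -> X = Y.
Proof.
case: X => X X1 X0; case: Y => Y Y1 Y0 /= pi XY.
have e : X = Y.
  apply/funext => j; have [pj|pj] := pselect (dom j p); last by rewrite X0 ?Y0.
  by rewrite (X1 i j) // (Y1 i j) // XY.
by subst Y; congr TVec; exact: Prop_irrelevance.
Qed.

Fact tzero_trans (p : T) (i j : idx A) : dom i p -> dom j p ->
  0 = 'd (trans i j) (coord i p) 0.
Proof. by rewrite linear0. Qed.

Definition tzero (p : T) : tvec p :=
  @TVec p (fun=> 0) (@tzero_trans p) (fun _ _ => erefl).

End Atlas.
Arguments tzero {R E T} A p.
Arguments tdiff {R E T A} f {p} X.

Record manifold (R : realType) (n : nat) := Manifold {
  carrier :> topologicalType;
  matlas : atlas 'rV[R]_n carrier;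
  manifold_hausdorff : hausdorff_space carrier;
  manifold_second_countable : @second_countable carrier;
  chart_atP : forall p, dom (chart_at matlas p) p;
  dom_open : forall i : idx matlas, open (dom i);
  coord_open : forall i : idx matlas, open (coord i @` dom i);
  coordK : forall (i : idx matlas) p, dom i p -> param i (coord i p) = p;
  coord_continuous : forall (i : idx matlas) p, dom i p ->
    {for p, continuous (coord i)};
  param_continuous : forall (i : idx matlas) p, dom i p ->
    {for coord i p, continuous (param i)};
  trans_smooth : forall (i j : idx matlas) k,
    Ck k (coord i @` (dom i `&` dom j)) (trans i j)
}.
Arguments chart_atP {R n} m p.

Section Manifold.
Variables (R : realType) (n : nat) (M : manifold R n).
Local Notation A := (matlas M).
Implicit Types (p : M) (i j k : idx A).

Lemma overlap_near i j p : dom i p -> dom j p ->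
  \forall x \near coord i p, dom i (param i x) /\ dom j (param i x) /\
    coord i (param i x) = x.
Proof.
move=> pi pj.
have n1 : \forall x \near coord i p, (coord i @` dom i) x.
  by apply: open_nbhs_nbhs; split; [exact: coord_open|exists p].
have n2 : \forall x \near coord i p, dom j (param i x).
  apply: (param_continuous pi); rewrite coordK //.
  by apply: open_nbhs_nbhs; split=> //; exact: dom_open.
apply: filterS2 n1 n2 => x [q qi <-]; rewrite coordK //.
Qed.

Lemma trans_differentiable i j p : dom i p -> dom j p ->
  differentiable (trans i j) (coord i p) /\
  forall v, differentiable (fun x => 'd (trans i j) x v) (coord i p).
Proof.
move=> pi pj; have [d1 d2] := trans_smooth i j 2.
by split; [apply: d1; exists p|move=> v; apply: (d2 v).1; exists p].
Qed.

Lemma diff_trans_id i p v : dom i p -> 'd (trans i i) (coord i p) v = v.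
Proof.
move=> pi.
have e : \forall x \near coord i p, id x = trans i i x.
  by apply: filterS (overlap_near pi pi) => x [_ []].
have did : differentiable id (coord i p) by exact: ex_diff.
have [_ ->] := near_eq_is_diff e did.
by rewrite diff_val.
Qed.

Lemma diff_trans_comp i j k p v : dom i p -> dom j p -> dom k p ->
  'd (trans i k) (coord i p) v =
  'd (trans j k) (coord j p) ('d (trans i j) (coord i p) v).
Proof.
move=> pi pj pk.
have tp : trans i j (coord i p) = coord j p by rewrite /trans /= coordK.
have [dij _] := trans_differentiable pi pj.
have [djk _] := trans_differentiable pj pk.
have djk' : differentiable (trans j k) (trans i j (coord i p)) by rewrite tp.
have e : \forall x \near coord i p, (trans j k \o trans i j) x = trans i k x.
  apply: filterS (overlap_near pi pj) => x [_ [xj _]].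
  by rewrite /trans /= coordK.
have [_ eD] := near_eq_is_diff e (differentiable_comp dij djk').
apply: (eq_trans (congr1 (@^~ v) eD)).
apply: (eq_trans (diff_compE v dij djk')).
by rewrite tp.
Qed.

(* The tangent vector at p whose components in the chart i are y. *)
Definition vec_of_comp (i : idx A) (p : M) (y : 'rV[R]_n) (j : idx A) : 'rV[R]_n :=
  if pselect (dom i p /\ dom j p) then 'd (trans i j) (coord i p) y else 0.

Lemma vec_of_compE i j p y : dom i p -> dom j p ->
  vec_of_comp i p y j = 'd (trans i j) (coord i p) y.
Proof. by rewrite /vec_of_comp => pi pj; case: pselect => // -[]. Qed.

Lemma vec_of_comp0 i j p y : ~ (dom i p /\ dom j p) -> vec_of_comp i p y j = 0.
Proof. by rewrite /vec_of_comp => h; case: pselect. Qed.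

Fact vec_of_comp_trans i p y j k : dom j p -> dom k p ->
  vec_of_comp i p y k = 'd (trans j k) (coord j p) (vec_of_comp i p y j).
Proof.
move=> pj pk; have [pi|pi] := pselect (dom i p).
  by rewrite !vec_of_compE //; exact: diff_trans_comp.
by rewrite !vec_of_comp0 ?linear0 // => -[].
Qed.

Fact vec_of_comp_out i p y j : ~ dom j p -> vec_of_comp i p y j = 0.
Proof. by move=> pj; rewrite vec_of_comp0 // => -[]. Qed.

Definition tvec_of_comp i p (y : 'rV[R]_n) : tvec A p :=
  TVec (@vec_of_comp_trans i p y) (@vec_of_comp_out i p y).

Lemma tvec_of_compK i p (X : tvec A p) : dom i p -> tvec_of_comp i p (X i) = X.
Proof.
by move=> pi; apply: (tvec_ext pi); rewrite /= vec_of_compE // diff_trans_id.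
Qed.

Definition tangent_bundle : Type := {p : M & tvec A p}.

Definition tpoint (u : tangent_bundle) : M := projT1 u.
Definition tvector (u : tangent_bundle) : tvec A (tpoint u) := projT2 u.

(* The natural charts (x, y) of the tangent bundle. *)
Definition natural_atlas : atlas ('rV[R]_n * 'rV[R]_n)%type tangent_bundle :=
  {| idx := idx A;
     dom := fun i => [set u | dom i (tpoint u)];
     coord := fun i u => (coord i (tpoint u), tvector u i);
     param := fun i z =>
       existT _ (param i z.1) (tvec_of_comp i (param i z.1) z.2);
     chart_at := fun u => chart_at A (tpoint u) |}.
Local Notation TA := natural_atlas.

Lemma natural_coordK i (u : tangent_bundle) : dom i (tpoint u) ->
  @param _ _ _ TA i (@coord _ _ _ TA i u) = u.
Proof.
case: u => p X /= pi; rewrite /tvector /tpoint /=.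
rewrite (coordK pi).
by rewrite tvec_of_compK.
Qed.

Lemma natural_overlap_near i j (u : tangent_bundle) :
    dom i (tpoint u) -> dom j (tpoint u) ->
  \forall z \near @coord _ _ _ TA i u, dom i (param i z.1) /\
    dom j (param i z.1) /\ coord i (param i z.1) = z.1.
Proof.
move=> ui uj.
have c : (fst : 'rV[R]_n * 'rV[R]_n -> 'rV[R]_n) @ (@coord _ _ _ TA i u) -->
    coord i (tpoint u) by exact: cvg_fst.
exact: c _ (overlap_near ui uj).
Qed.

Lemma natural_transE i j (u : tangent_bundle) :
    dom i (tpoint u) -> dom j (tpoint u) ->
  [/\ differentiable (@trans _ _ _ TA i j) (@coord _ _ _ TA i u),
      forall z, ('d (@trans _ _ _ TA i j) (@coord _ _ _ TA i u) z).1 =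
        'd (trans i j) (coord i (tpoint u)) z.1 &
      forall v, 'd (@trans _ _ _ TA i j) (@coord _ _ _ TA i u) (0, v) =
        (0, 'd (trans i j) (coord i (tpoint u)) v)].
Proof.
move=> ui uj; have [d1 d2] := trans_differentiable ui uj.
have [dG G1 G2] := is_diff_tangent_map (tvector u i) d1 d2.
have e : \forall z \near @coord _ _ _ TA i u,
    (trans i j z.1, 'd (trans i j) (z.1 : 'rV[R]_n) z.2) = @trans _ _ _ TA i j z.
  apply: filterS (natural_overlap_near ui uj) => z [xi [xj xK]].
  have E := vec_of_compE z.2 xi xj; rewrite xK in E.
  exact: (f_equal2 pair erefl (esym E)).
have [dT TE] := near_eq_is_diff e dG.
have TEz z := congr1 (@^~ z) TE.
split=> [|z|v]; first exact: dT.
  exact: (eq_trans (congr1 fst (TEz z)) (G1 z)).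
exact: (eq_trans (TEz (0, v)) (G2 v)).
Qed.

(* d(pi)(X), with components xi when X has components (xi, eta). *)
Definition push_comp (u : tangent_bundle) (X : tvec TA u) (i : idx A) : 'rV[R]_n :=
  (X i).1.

Fact push_trans u (X : tvec TA u) i j : dom i (tpoint u) -> dom j (tpoint u) ->
  push_comp X j = 'd (trans i j) (coord i (tpoint u)) (push_comp X i).
Proof.
move=> ui uj; rewrite /push_comp (comp_trans X (i := i) (j := j)) //.
by have [_ -> _] := natural_transE ui uj.
Qed.

Fact push_out u (X : tvec TA u) i : ~ dom i (tpoint u) -> push_comp X i = 0.
Proof. by move=> ui; rewrite /push_comp (comp_out X (i := i)). Qed.

Definition push u (X : tvec TA u) : tvec A (tpoint u) :=
  TVec (push_trans X) (@push_out u X).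

(* The vertical lift of w to the point u, with components (0, w). *)
Fact vlift_trans (u : tangent_bundle) (w : tvec A (tpoint u)) (i j : idx TA) :
  dom i u -> dom j u ->
  (0, w j) = 'd (trans i j) (coord i u) (0, w i).
Proof.
move=> ui uj; have [_ _ h] := natural_transE ui uj.
by rewrite [RHS]h (comp_trans w ui uj).
Qed.

Fact vlift_out (u : tangent_bundle) (w : tvec A (tpoint u)) (i : idx TA) :
  ~ dom i u -> (0, w i) = 0 :> 'rV[R]_n * 'rV[R]_n.
Proof. by move=> ui; rewrite (comp_out w ui). Qed.

Definition vlift (u : tangent_bundle) (w : tvec A (tpoint u)) : tvec TA u :=
  TVec (@vlift_trans u w) (@vlift_out u w).

(* J(d/dx^i) = d/dy^i and J(d/dy^i) = 0, that is J(xi, eta) = (0, xi). *)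
Definition almost_tangent u (X : tvec TA u) : tvec TA u := vlift (push X).

(* y^i d/dy^i *)
Definition liouville u : tvec TA u := vlift (tvector u).

Definition dJ (f : tangent_bundle -> R) u (X : tvec TA u) : R :=
  tdiff f (almost_tangent X).

Lemma tdiffE (f : tangent_bundle -> R) u (X : tvec TA u) (i : idx TA) :
  differentiable_on TA [set u] f -> dom i u ->
  tdiff f X = 'd (f \o param i) (coord i u) (X i).
Proof.
rewrite /tdiff; set c := chart_at TA u => df ui.
have uc : dom c u := chart_atP M (tpoint u).
have dfc : differentiable (f \o param c) (coord c u) by exact: df.
have [dt _ _] := natural_transE ui uc.
have tu : trans i c (coord i u) = coord c u.
  exact: (congr1 (coord c) (natural_coordK ui)).
have dfc' : differentiable (f \o param c) (trans i c (coord i u)) by rewrite tu.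
have e : \forall z \near coord i u, ((f \o param c) \o trans i c) z = (f \o param i) z.
  apply: filterS (natural_overlap_near ui uc) => z [_ [xc _]].
  exact: (congr1 f (@natural_coordK c (param i z) xc)).
have [_ eD] := near_eq_is_diff e (differentiable_comp dt dfc').
apply: (eq_trans _ (esym (congr1 (@^~ (X i)) eD))).
apply: (eq_trans _ (esym (diff_compE (X i) dt dfc'))).
by rewrite tu (comp_trans X ui uc).
Qed.

Definition slit : set tangent_bundle := [set u | tvector u <> tzero A (tpoint u)].

(* g_ij = (1/2) d^2(L^2)/dy^i dy^j in the natural chart selected at u. *)
Definition metric_comp (L : tangent_bundle -> R) (u : tangent_bundle)
    (i j : 'I_n) : R :=
  let c := chart_at TA u in
  let F z := L (param c z) ^+ 2 in
  2^-1 * 'D_(0, delta_mx 0 i) ('D_(0, delta_mx 0 j) F) (coord c u).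

Definition metric (L : tangent_bundle -> R) (u : tangent_bundle)
    (X Y : tvec A (tpoint u)) : R :=
  let c := chart_at A (tpoint u) in
  \sum_(i < n) \sum_(j < n) metric_comp L u i j * X c 0 i * Y c 0 j.

(* Regularity along the zero section.  As L is positively homogeneous of degree
   one along the fibres, being C^1 on the whole tangent bundle contradicts
   positive definiteness as soon as n > 0 and a nonzero tangent vector exists:
   read literally, that condition leaves no Finsler manifold of positive
   dimension.  The second alternative therefore admits, for n >= 2, the
   condition satisfied by genuine Finsler functions, namely that the energy
   L^2 is C^1 on the tangent bundle. *)
Record finsler (L : tangent_bundle -> R) : Prop := Finsler {
  finsler_ge0 : forall u, 0 <= L u;
  finsler0 : forall p, L (existT _ p (tzero A p)) = 0;
  finsler_smooth : forall k : nat, Ck_on TA k slit L;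
  finsler_C1 : Ck_on TA 1 setT L \/
    ((2 <= n)%N /\ Ck_on TA 1 setT (fun u => L u ^+ 2));
  finsler_homogeneous : forall u, slit u -> tdiff L (liouville u) = L u;
  finsler_posdef : forall u (X : tvec A (tpoint u)), slit u ->
    X <> tzero A (tpoint u) -> 0 < metric L X X
}.

(* Sections of the pullback of the tangent bundle to the bundle [slit] of
   nonzero tangent vectors. *)
Definition pullback_section :=
  forall u : {u : tangent_bundle | slit u}, tvec A (tpoint (sval u)).

Definition conformal (L L' : tangent_bundle -> R) :=
  exists psi : tangent_bundle -> R,
    [/\ forall u, 0 < psi u,
        differentiable_on TA setT psi &
        forall (X Y : pullback_section) u,
          metric L' (X u) (Y u) = psi (sval u) * metric L (X u) (Y u)].

End Manifold.

(* Main.v *)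
From Pilot Require Import Defs.
From mathcomp Require Import all_boot all_order all_algebra.
From mathcomp Require Import all_classical all_reals all_analysis.
From mathcomp Require Import ring.
Set Implicit Arguments.
Unset Strict Implicit.
Unset Printing Implicit Defensive.
Import Order.TTheory GRing.Theory Num.Theory.
Import numFieldNormedType.Exports.
(* [vector] also exports a [coord]; the chart map of an atlas is meant below. *)
Import Pilot.Defs.
Local Open Scope classical_set_scope.
Local Open Scope ring_scope.

(** In a natural chart (x, y) write F = L^2 for the energy.
    Homogeneity gives the Euler relation sum_j y^j dF/dy^j = 2 F; differentiating
    it along y^i yields sum_j g_ij y^j = (1/2) dF/dy^i.  Contracting the metric
    with the tautological section therefore recovers both L and its vertical
    differential: g(w, y) = L(y) dL(w^v) ([metric_tvector]), where w^v is the
    vertical lift of w, and g(y, y) = L(y)^2 ([metric_self]).  In particular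
    L > 0 away from the zero section.

    If g' = psi g, contracting with (w, y) and with (y, y) gives
    L' dL'(w^v) = psi L dL(w^v) and L'^2 = psi L^2, whose quotient is the
    equality of the two logarithmic vertical differentials ([conformal_dJ]).

    Conversely, that equality says that L'/L has zero differential along the
    fibres.  It is therefore constant on each punctured fibre, provided that
    this is connected, that is, n >= 2.  In dimension one it is disconnected,
    but the only regularity that [finsler] then allows is C^1 along the zero
    section, and this is contradictory: along a ray dL is constant, so by
    continuity dL(0)(v) = L(v) > 0 for every v <> 0, whereas dL(0) is odd in v
    ([finsler_dim_ge2]).  Connectedness is used through lines missing the
    origin: two independent vectors lie on such a line, and two dependent ones
    are both joined to a third vector independent of them ([ratio_fibre]).  The
    conformal factor at (x, y) is then the square of L'/L at any nonzero vector
    over x; it is differentiable since it can be computed on a vector with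
    constant components in a chart.  As it does not depend on y,
    differentiating L'^2 = psi L^2 twice along the fibres gives g' = psi g
    ([metric_comp_scale]). *)

(** * Calculus along the fibres of the model space *)

Lemma is_derive_line (R : realType) (E : normedModType R) (f : E -> R)
    (a b : E) (t : R) :
  differentiable f (a + t *: b) ->
  is_derive t 1 (fun s : R => f (a + s *: b)) ('d f (a + t *: b) b).
Proof.
move=> df.
have E1 : (fun h : R => h^-1 *: (((fun s : R => f (a + s *: b)) \o shift t) (h *: 1)
      - f (a + t *: b)))
    = (fun h : R => h^-1 *: ((f \o shift (a + t *: b)) (h *: b) - f (a + t *: b))).
  apply/funext => h /=.
  by rewrite [h *: 1]mulr1 scalerDl addrCA.
apply: DeriveDef.
  by rewrite /derivable E1; exact: diff_derivable.
by rewrite /derive E1; exact: deriveE.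
Qed.

Lemma is_derive_vertical_coord (R : realType) (n : nat) (j : 'I_n)
    (z : 'rV[R]_n * 'rV[R]_n) (v : 'rV[R]_n) :
  is_derive z (0, v) (fun w : 'rV[R]_n * 'rV[R]_n => w.2 0 j : R) (v 0 j).
Proof.
have K : (fun h : R => h^-1 *: (((fun w : 'rV[R]_n * 'rV[R]_n => w.2 0 j : R)
      \o shift z) (h *: (0, v)) - z.2 0 j)) @ 0^' --> v 0 j.
  apply: (@cvg_trans _ ((cst (v 0 j) : R -> R) @ 0^')); last exact: cvg_cst.
  apply: near_eq_cvg; near=> h.
  rewrite /= !mxE addrK /GRing.scale /= mulrA mulVf ?mul1r //.
  by near: h; exact: nbhs_dnbhs_neq.
by apply: DeriveDef; [apply/cvg_ex; exists (v 0 j)|apply: cvg_lim].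
Unshelve. all: by end_near. Qed.

(** The directional derivatives that enter [metric_comp] determine the vertical
    part of the differential. *)
Lemma derive_vertical_sum (R : realType) (n : nat)
    (f : 'rV[R]_n * 'rV[R]_n -> R) (z : 'rV[R]_n * 'rV[R]_n) (v : 'rV[R]_n) :
  differentiable f z ->
  'd f z (0, v) = \sum_(j < n) v 0 j * 'D_(0, delta_mx 0 j) f z.
Proof.
move=> df.
have -> : (0, v) = \sum_(j < n) v 0 j *: (0, delta_mx 0 j)
    :> 'rV[R]_n * 'rV[R]_n.
  rewrite {1}(row_sum_delta v); elim/big_ind2: _ => //= [|j _].
    by move=> x1 x2 y1 y2 <- <-; congr pair; rewrite addr0.
  by congr pair; rewrite scaler0.
rewrite linear_sum; apply: eq_bigr => j _.
by rewrite linearZ deriveE.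
Qed.

(** The Euler relation for a 2-homogeneous function, differentiated along y^i:
    the product rule yields an extra dF/dy^i on the left and twice that on the
    right. *)
Lemma euler_derive (R : realType) (n : nat)
    (F : 'rV[R]_n * 'rV[R]_n -> R) (z : 'rV[R]_n * 'rV[R]_n) (i : 'I_n) :
  (\forall w \near z, differentiable F w /\ 'd F w (0, w.2) = 2 * F w) ->
  (forall j, derivable ('D_(0, delta_mx 0 j) F) z (0, delta_mx 0 i)) ->
  \sum_(j < n) z.2 0 j * 'D_(0, delta_mx 0 i) ('D_(0, delta_mx 0 j) F) z =
  'D_(0, delta_mx 0 i) F z.
Proof.
move=> euler dF.
set e := (0, delta_mx 0 i).
pose G (w : 'rV[R]_n * 'rV[R]_n) := 2 * F w.
have dFz : derivable F z e by apply: diff_derivable; exact: (nbhs_singleton euler).1.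
have GD : is_derive z e G (2 * 'D_e F z).
  exact: (@is_deriveZ _ _ _ F 2 z e _ (derivableP dFz)).
pose T (j : 'I_n) (w : 'rV[R]_n * 'rV[R]_n) : R :=
  w.2 0 j * 'D_(0, delta_mx 0 j) F w.
have TD (j : 'I_n) : is_derive z e (T j)
    (z.2 0 j * 'D_e ('D_(0, delta_mx 0 j) F) z
     + 'D_(0, delta_mx 0 j) F z * (j == i)%:R).
  have -> : (j == i)%:R = (delta_mx 0 i : 'rV[R]_n) 0 j by rewrite mxE eqxx.
  exact: (is_deriveM (is_derive_vertical_coord j z (delta_mx 0 i))
            (derivableP (dF j))).
have SD := is_derive_sum TD.
have GT : \near z, (\sum_(j < n) T j) z = G z.
  apply: filterS euler => w [dw ew].
  by rewrite /G -ew derive_vertical_sum // fct_sumE.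
have := near_eq_derive e GT.
rewrite (derive_val (is_derive := SD)) (derive_val (is_derive := GD)).
rewrite big_split /=.
have -> : \sum_(j < n) 'D_(0, delta_mx 0 j) F z * (j == i)%:R = 'D_e F z.
  rewrite (bigD1 i) //= eqxx mulr1 big1 ?addr0 // => j /negbTE ->.
  by rewrite mulr0.
move=> /eqP; rewrite mulr_natl mulr2n -subr_eq0 opprD addrACA subrr addr0 subr_eq0.
by move/eqP.
Qed.

(** A factor k depending on x only is a constant on the vertical line through z. *)
Lemma derive_vertical_scale (R : realType) (n : nat)
    (F G : 'rV[R]_n * 'rV[R]_n -> R) (k : 'rV[R]_n -> R)
    (z : 'rV[R]_n * 'rV[R]_n) (v : 'rV[R]_n) :
  (forall w, G w = k w.1 * F w) -> derivable F z (0, v) ->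
  'D_(0, v) G z = k z.1 * 'D_(0, v) F z.
Proof.
move=> GE dF; rewrite -[RHS](deriveZ (k z.1) dF) /derive.
set q := (X in lim (X @ _) = _); set r := (X in _ = lim (X @ _)).
suff -> : q = r by [].
apply/funext => h; rewrite /q /r /= !GE /=.
by rewrite scaler0 add0r.
Qed.

(** * Natural charts of the tangent bundle *)
Section TangentBundle.
Variables (R : realType) (n : nat) (M : manifold R n).
Local Notation TM := (tangent_bundle M).
Local Notation TA := (natural_atlas M).
Local Notation A := (matlas M).
Implicit Types (u : TM) (i j k : idx TA).

Lemma slitP i u : dom i u -> slit u <-> tvector u i <> 0.
Proof.
move=> ui; split=> h e; apply: h; last by rewrite e.
exact: (tvec_ext (A := A) (i := i) ui).
Qed.

Lemma tvec_of_comp_diag (p : M) i (y : 'rV[R]_n) :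
  @dom _ _ _ A i p -> tvec_of_comp i p y i = y.
Proof. by move=> pi; rewrite /= vec_of_compE // diff_trans_id. Qed.

Lemma slit_param i (p : M) (y : 'rV[R]_n) : @dom _ _ _ A i p -> y <> 0 ->
  slit (existT _ p (tvec_of_comp i p y) : TM).
Proof.
move=> pi y0; apply/(@slitP i (existT _ p _) pi).
by rewrite (@tvec_of_comp_diag p i y pi).
Qed.

Lemma natural_paramK i (z : 'rV[R]_n * 'rV[R]_n) :
  @dom _ _ _ A i (@param _ _ _ A i z.1) ->
  @coord _ _ _ A i (@param _ _ _ A i z.1) = z.1 ->
  @coord _ _ _ TA i (@param _ _ _ TA i z) = z.
Proof.
case: z => x y /= xi xK; rewrite /tvector /tpoint /= xK; congr pair.
exact: tvec_of_comp_diag.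
Qed.

Lemma dom_near i u : dom i u ->
  \forall z \near coord i u, dom i (param i z) /\ coord i (param i z) = z.
Proof.
move=> ui; apply: filterS (natural_overlap_near ui ui) => z [zi [_ zK]].
by split=> //; exact: natural_paramK.
Qed.

Lemma slit_near i u : dom i u -> slit u ->
  \forall z \near coord i u,
    [/\ dom i (param i z), slit (param i z) & coord i (param i z) = z].
Proof.
move=> ui us.
have y0 : (coord i u).2 != 0 by apply/eqP; exact: (slitP ui).1.
have c : (snd : 'rV[R]_n * 'rV[R]_n -> 'rV[R]_n) @ (coord i u) -->
  (coord i u).2 by exact: cvg_snd.
have h2 : \forall y \near (coord i u).2, y != 0.
  have o : open (~` [set (0 : 'rV[R]_n)]).
    rewrite openC; apply: accessible_closed_set1.
    by apply: hausdorff_accessible; exact: norm_hausdorff.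
  apply: (filterS _ (open_nbhs_nbhs (conj o (elimN eqP y0)))) => y yn.
  exact/eqP.
have n2 : \forall z \near coord i u, z.2 != 0 by exact: c _ h2.
apply: filterS2 (dom_near ui) n2 => z [zi zK] /eqP z2; split=> //.
apply/(slitP zi) => e; apply: z2.
by rewrite -{}[in LHS]zK.
Qed.

(** Cocycle rule for the coordinate changes of the tangent bundle, needed to
    build tangent vectors to the bundle from their components. *)
Lemma diff_natural_trans_comp i j k u (z : 'rV[R]_n * 'rV[R]_n) :
  dom i u -> dom j u -> dom k u ->
  'd (trans i k) (coord i u) z =
  'd (trans j k) (coord j u) ('d (trans i j) (coord i u) z).
Proof.
move=> ui uj uk.
have tu : trans i j (coord i u) = coord j u.
  exact: (congr1 (coord j) (natural_coordK ui)).
have [dij _ _] := natural_transE ui uj.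
have [djk _ _] := natural_transE uj uk.
have djk' : differentiable (trans j k) (trans i j (coord i u)) by rewrite tu.
have e : \forall w \near coord i u, (trans j k \o trans i j) w = trans i k w.
  apply: filterS (natural_overlap_near ui uj) => w [_ [wj _]].
  exact: (congr1 (coord k) (@natural_coordK _ _ _ j (param i w) wj)).
have [_ eD] := near_eq_is_diff e (differentiable_comp dij djk').
apply: (eq_trans (congr1 (@^~ z) eD)).
apply: (eq_trans (diff_compE z dij djk')).
by rewrite tu.
Qed.

(** Turns an identity between tangent vectors into one between all their
    components in a given chart. *)
Lemma exists_tangent_comp i u (z : 'rV[R]_n * 'rV[R]_n) : dom i u ->
  exists X : tvec TA u, X i = z.
Proof.
move=> ui.
pose X j : 'rV[R]_n * 'rV[R]_n :=
  if pselect (dom j u) then 'd (trans i j) (coord i u) z else 0.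
have XE j : dom j u -> X j = 'd (trans i j) (coord i u) z.
  by rewrite /X; case: pselect.
have X1 j k : dom j u -> dom k u -> X k = 'd (trans j k) (coord j u) (X j).
  by move=> uj uk; rewrite !XE //; exact: diff_natural_trans_comp.
have X0 j : ~ dom j u -> X j = 0 by rewrite /X; case: pselect.
exists (TVec X1 X0); rewrite /= XE //.
have e : \forall w \near coord i u, id w = trans i i w.
  by apply: filterS (dom_near ui) => w [].
have did : differentiable id (coord i u) by exact: ex_diff.
have [_ ->] := near_eq_is_diff e did.
by rewrite diff_val.
Qed.

End TangentBundle.

(** * Euler relations for Finsler functions *)
Section Finsler.
Variables (R : realType) (n : nat) (M : manifold R n).
Local Notation TM := (tangent_bundle M).
Local Notation TA := (natural_atlas M).
Local Notation A := (matlas M).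
Variables (L : TM -> R) (hL : finsler L).
Implicit Types (u : TM) (i : idx TA).

Lemma finsler_diff i u : dom i u -> slit u ->
  differentiable (L \o param i) (coord i u).
Proof. by move=> ui us; apply: (finsler_smooth hL 1 i).1; exists u. Qed.

Lemma finsler_diff2 i u (v : 'rV[R]_n * 'rV[R]_n) : dom i u -> slit u ->
  differentiable (fun z => 'd (L \o param i) z v) (coord i u).
Proof.
by move=> ui us; apply: ((finsler_smooth hL 2 i).2 v).1; exists u.
Qed.

Lemma finsler_differentiable_on u : slit u -> differentiable_on TA [set u] L.
Proof. by move=> us i v vi vu; rewrite vu in vi *; exact: finsler_diff. Qed.

Lemma finsler_tdiffE i u (X : tvec TA u) : dom i u -> slit u ->
  tdiff L X = 'd (L \o param i) (coord i u) (X i).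
Proof. by move=> ui us; apply: tdiffE => //; exact: finsler_differentiable_on. Qed.

Lemma finsler_euler i u : dom i u -> slit u ->
  'd (L \o param i) (coord i u) (0, (coord i u).2) = L u.
Proof.
move=> ui us; rewrite -[RHS](finsler_homogeneous hL us).
exact/esym/(finsler_tdiffE (liouville u)).
Qed.

Lemma energy_diff i u (F := fun z => L (param i z) ^+ 2)
    (v : 'rV[R]_n * 'rV[R]_n) : dom i u -> slit u ->
  differentiable F (coord i u) /\
  'd F (coord i u) v = 2 * L u * 'd (L \o param i) (coord i u) v.
Proof.
move=> ui us; have df := finsler_diff ui us.
have FE : F = (L \o param i) ^+ 2 by apply/funext => z; rewrite exprfctE.
have dF : differentiable F (coord i u).
  by rewrite FE; apply: differentiableX.
split=> //; rewrite -deriveE // FE.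
have D := is_deriveX 2 (derivableP (@diff_derivable _ _ _ _ _ v df)).
rewrite (derive_val (is_derive := D)) deriveE // expr1.
have LE : (L \o param i) (coord i u) = L u.
  exact: (congr1 L (natural_coordK ui)).
by rewrite LE.
Qed.

Lemma energy_derivable2 i u (F := fun z => L (param i z) ^+ 2) (j : 'I_n)
    (e : 'rV[R]_n * 'rV[R]_n) : dom i u -> slit u ->
  derivable ('D_(0, delta_mx 0 j) F) (coord i u) e.
Proof.
move=> ui us.
pose v : 'rV[R]_n * 'rV[R]_n := (0, delta_mx 0 j).
pose G z := 2 * (L \o param i) z * 'd (L \o param i) z v.
apply: (@near_eq_derivable _ _ _ G).
  apply: filterS (slit_near ui us) => z [zi zs zK].
  have [dFz FE] := energy_diff v zi zs.
  by rewrite zK in dFz FE; rewrite deriveE.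
apply: diff_derivable; rewrite /G.
have d1 := differentiableZ 2 (finsler_diff ui us).
exact: (differentiableM d1 (finsler_diff2 v ui us)).
Qed.

(** The key identity: contracting the metric with the tautological section
    y yields the vertical differential of the energy, sum_j g_ij y^j =
    (1/2) d(L^2)/dy^i = L dL/dy^i. *)
Lemma metric_tvector u (w : tvec A (tpoint u)) : slit u ->
  metric L w (tvector u) = L u * tdiff L (vlift w).
Proof.
move=> us; set c := chart_at A (tpoint u).
have uc : @dom _ _ _ TA c u := chart_atP M (tpoint u).
pose F z := L (@param _ _ _ TA c z) ^+ 2.
have near_u := slit_near uc us.
have euler : \forall z \near @coord _ _ _ TA c u,
    differentiable F z /\ 'd F z (0, z.2) = 2 * F z.
  apply: filterS near_u => z [zc zs zK].
  have [dF FE] := energy_diff (0, z.2) zc zs.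
  rewrite zK in dF FE; split=> //.
  have := finsler_euler zc zs; rewrite zK => E.
  by rewrite [LHS]FE E /F expr2 mulrA.
have dF j e := @energy_derivable2 c u j e uc us.
rewrite (finsler_tdiffE (vlift w) uc us) /metric -/c.
have [dFu _] := energy_diff 0 uc us.
transitivity (2^-1 * 'd F (@coord _ _ _ TA c u) (0, w c)); last first.
  rewrite (energy_diff (0, w c) uc us).2 !mulrA mulVf ?mul1r // pnatr_eq0.
rewrite derive_vertical_sum // mulr_sumr; apply: eq_bigr => i _.
rewrite -(euler_derive euler (fun j => dF j _)) !mulr_sumr.
apply: eq_bigr => j _; rewrite /metric_comp -/c -/F.
by rewrite /= -!mulrA; congr (_ * _); rewrite mulrC -!mulrA; congr (_ * _);
  rewrite mulrC.
Qed.

(** If the energies differ by a factor depending on the base point only, this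
    factor passes through the two vertical derivatives defining the metric. *)
Lemma metric_comp_scale (L' : TM -> R) (phi : M -> R) u : slit u ->
  (forall v, L' v ^+ 2 = phi (tpoint v) * L v ^+ 2) ->
  forall a b : 'I_n, metric_comp L' u a b = phi (tpoint u) * metric_comp L u a b.
Proof.
move=> us energyE a b; rewrite /metric_comp.
set c := chart_at TA u; have uc : dom c u := chart_atP M (tpoint u).
pose F z := L (param c z) ^+ 2; pose F' z := L' (param c z) ^+ 2.
pose psi (x : 'rV[R]_n) := phi (@param _ _ _ A c x).
have F'E z : F' z = psi z.1 * F z by exact: energyE.
have inner : \forall z \near coord c u, 'D_(0, delta_mx 0 b) F' z =
    psi z.1 * 'D_(0, delta_mx 0 b) F z.
  apply: filterS (slit_near uc us) => z [zc zs zK].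
  have [dF _] := energy_diff 0 zc zs; rewrite zK in dF.
  exact/derive_vertical_scale/diff_derivable.
have -> : phi (tpoint u) = psi (coord c u).1.
  by rewrite /psi /= (coordK (m := M) (p := tpoint u) uc).
rewrite (near_eq_derive _ inner) mulrCA; congr (_ * _).
by apply: derive_vertical_scale => //; exact: energy_derivable2.
Qed.

Lemma metric_self u : slit u -> metric L (tvector u) (tvector u) = L u ^+ 2.
Proof.
by move=> us; rewrite metric_tvector // (finsler_homogeneous hL us) expr2.
Qed.

Lemma finsler_gt0 u : slit u -> 0 < L u.
Proof.
move=> us; rewrite lt_def (finsler_ge0 hL) andbT.
have := finsler_posdef hL us us; rewrite metric_self // => h.
by apply/eqP => e; rewrite e expr0n ltxx in h.
Qed.

Lemma finsler_off_slit u : ~ slit u -> L u = 0.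
Proof.
move=> us; have {us} : tvector u = tzero A (tpoint u) by exact: contrapT.
case: u => p X; rewrite /tvector /tpoint /= => ->; exact: finsler0.
Qed.

End Finsler.

(** * Conformal metrics have proportional vertical differentials *)
Section Forward.
Variables (R : realType) (n : nat) (M : manifold R n).
Local Notation TM := (tangent_bundle M).
Local Notation TA := (natural_atlas M).
Local Notation A := (matlas M).

(** Components held constant in one chart; the vector is zero outside its
    domain, which is harmless as sections carry no continuity condition. *)
Lemma exists_pullback_section (u : {u : TM | slit u})
    (w : tvec A (tpoint (sval u))) :
  exists s : pullback_section M, s u = w.
Proof.
set c := chart_at A (tpoint (sval u)).
exists (fun v => tvec_of_comp c (tpoint (sval v)) (w c)).
exact: tvec_of_compK (chart_atP M _).
Qed.

(** Dividing g'(w, y) = psi g(w, y) by g'(y, y) = psi g(y, y) eliminates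
    psi. *)
Lemma conformal_dJ (L L' : TM -> R) (hL : finsler L) (hL' : finsler L') :
  conformal L L' ->
  forall u, slit u -> forall X : tvec TA u, dJ L' X / L' u = dJ L X / L u.
Proof.
move=> [psi [_ _ met]] u us X.
have conf (w : tvec A (tpoint u)) :
    metric L' w (tvector u) = psi u * metric L w (tvector u).
  have [s sE] := @exists_pullback_section (exist _ u us) w.
  have [t tE] := @exists_pullback_section (exist _ u us) (tvector u).
  by have := met s t (exist _ u us); rewrite sE tE.
have lu : L u != 0 by rewrite gt_eqF // finsler_gt0.
have lu' : L' u != 0 by rewrite gt_eqF // finsler_gt0.
have := conf (push X); rewrite !metric_tvector // => E1.
have := conf (tvector u); rewrite !metric_self // => E2.
apply: (mulfI (x := L' u ^+ 2)); first by rewrite expf_neq0.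
rewrite {1}expr2 -mulrA (mulrCA (L' u) (dJ L' X)) mulfV // mulr1 E1 E2.
by rewrite /dJ /almost_tangent expr2 -!mulrA; congr (_ * (_ * _));
  rewrite mulrCA mulfV // mulr1.
Qed.

End Forward.

(** * Lines avoiding the origin *)

Lemma exists_noncollinear (R : realType) (n : nat) (y : 'rV[R]_n) :
  (2 <= n)%N -> exists w : 'rV[R]_n, forall k : R, w <> k *: y.
Proof.
case: n y => [|[|n]] // y _; apply: contrapT => /forallNP h.
have col w : exists k : R, w = k *: y.
  by have /existsNP[k /contrapT] := h w; exists k.
have [a aE] := col (delta_mx 0 ord0).
have [b bE] := col (delta_mx 0 ord_max).
have a00 := congr1 (fun v : 'rV[R]_n.+2 => v 0 ord0) aE.
have a01 := congr1 (fun v : 'rV[R]_n.+2 => v 0 ord_max) aE.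
have b00 := congr1 (fun v : 'rV[R]_n.+2 => v 0 ord0) bE.
have b01 := congr1 (fun v : 'rV[R]_n.+2 => v 0 ord_max) bE.
rewrite !mxE /= in a00 a01 b00 b01.
have /eqP : a * y 0 ord_max = 0 by rewrite -a01.
rewrite mulf_eq0 => /orP[]/eqP e.
  have : (1 : R) = 0 by rewrite [LHS]a00 e mul0r.
  by move/eqP; rewrite oner_eq0.
have : (1 : R) = 0 by rewrite -[RHS](mulr0 b) -e -b01 eqxx.
by move/eqP; rewrite oner_eq0.
Qed.

(** The whole affine line, not just the segment, avoids 0; a function with zero
    derivative on all of R can then be used to compare its values at y and w. *)
Lemma noncollinear_line (R : realType) (n : nat) (y w : 'rV[R]_n) :
  y <> 0 -> (forall k : R, w <> k *: y) -> forall t : R, y + t *: (w - y) <> 0.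
Proof.
move=> y0 hw t e; have [t0|t0] := eqVneq t 0.
  by apply: y0; rewrite t0 scale0r addr0 in e.
(* y + t (w - y) = 0 with t <> 0 means w = ((t - 1) / t) y *)
apply: (hw (t^-1 * (t - 1))); rewrite -scalerA scalerBl scale1r.
have -> : t *: y - y = t *: w.
  move: e; rewrite scalerBr => /eqP.
  by rewrite addrCA -opprB subr_eq0 => /eqP.
by rewrite scalerA mulVf // scale1r.
Qed.

(** * A Finsler manifold with a nonzero vector has dimension at least two *)
Section Fibres.
Variables (R : realType) (n : nat) (M : manifold R n).
Local Notation TM := (tangent_bundle M).
Local Notation TA := (natural_atlas M).
Local Notation A := (matlas M).
Implicit Types (u : TM) (i : idx TA) (p : M).

Lemma fibre_paramK i p (y : 'rV[R]_n) (u := @param _ _ _ TA i (@coord _ _ _ A i p, y)) :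
  @dom _ _ _ A i p -> dom i u /\ coord i u = (@coord _ _ _ A i p, y).
Proof.
move=> pi; have pK : @param _ _ _ A i (@coord _ _ _ A i p) = p by exact: coordK.
by split; [rewrite /= pK|apply: natural_paramK; rewrite /= pK].
Qed.

Lemma fibre_slit i p (y : 'rV[R]_n) : @dom _ _ _ A i p -> y <> 0 ->
  slit (@param _ _ _ TA i (@coord _ _ _ A i p, y)).
Proof.
by move=> pi y0; apply: slit_param => //; rewrite coordK.
Qed.

Section Dimension.
Variables (L : TM -> R) (hL : finsler L).

(** The differential along a ray is constant, because L itself is linear there:
    reparametrizing the ray by t = exp s makes L / t a function on all of R,
    whose derivative vanishes by the Euler relation. *)
Lemma finsler_ray i p (v : 'rV[R]_n) (t : R) : @dom _ _ _ A i p -> v <> 0 ->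
  0 < t ->
  'd (L \o @param _ _ _ TA i) (@coord _ _ _ A i p, t *: v) (0, v) =
  L (@param _ _ _ TA i (@coord _ _ _ A i p, v)).
Proof.
move=> pi v0 t0; set x := @coord _ _ _ A i p.
set l := L \o @param _ _ _ TA i.
have lineE (s : R) : (x, 0) + s *: (0, v) = (x, s *: v) :> 'rV[R]_n * 'rV[R]_n.
  have e1 : x + s *: 0 = x by rewrite scaler0 addr0.
  exact: (f_equal2 pair e1 (add0r (s *: v))).
have sv (s : R) : 0 < s -> s *: v <> 0.
  by move=> s0 /eqP; rewrite scaler_eq0 gt_eqF //= => /eqP.
have dl (s : R) : 0 < s -> differentiable l (x, s *: v).
  move=> s0; have [ui uK] := fibre_paramK (s *: v) pi.
  rewrite -[X in differentiable _ X]uK; apply: finsler_diff => //.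
  by apply: fibre_slit => //; exact: sv.
have euler (s : R) : 0 < s -> s * 'd l (x, s *: v) (0, v) = l (x, s *: v).
  move=> s0; have [ui uK] := fibre_paramK (s *: v) pi.
  have := finsler_euler hL ui (fibre_slit pi (sv _ s0)).
  rewrite uK => E; apply: (eq_trans _ E).
  rewrite -[LHS]linearZ; congr ('d l _ _).
  exact: (f_equal2 pair (scaler0 _ s) erefl).
pose f := ((fun s : R => l ((x, 0) + s *: (0, v))) \o expR) * (expR \o -%R).
have f' (s : R) : is_derive s 1 f 0.
  have dls := dl _ (expR_gt0 s); rewrite -lineE in dls.
  have D1 := is_derive1_comp (is_derive_line dls) (is_derive_expR s).
  have D2 := is_derive1_comp (is_derive_expR (- s)) (is_deriveNid s 1).
  apply: (is_derive_eq (is_deriveM D1 D2)).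
  rewrite /= lineE mulrN1 scalerN [_ *: expR _]mulrC [_ *: (_ * expR _)]mulrC.
  rewrite [_ * expR s]mulrC euler ?expR_gt0 //.
  by rewrite mulrC addNr.
have hom : l (x, t *: v) = t * l (x, v).
  have := @is_derive_0_is_cst _ f (ln t) 0 f'.
  rewrite /f !fctE /= oppr0 expR0 mulr1 expRN lnK ?posrE // !lineE scale1r.
  by move=> <-; rewrite mulrC divfK ?gt_eqF.
apply: (mulfI (x := t)); first by rewrite gt_eqF.
by rewrite euler.
Qed.

(** Only the alternative that L is C^1 on the whole tangent bundle has to be
    excluded.  Under it, the value of the vertical differential at the zero
    vector is the limit along each ray, dL(0)(v) = L(v) > 0; applied to v and
    to - v, this contradicts linearity. *)
Lemma finsler_dim_ge2 u : slit u -> (2 <= n)%N.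
Proof.
move=> us; case: (finsler_C1 hL) => [C1|[]//]; exfalso.
set i := chart_at TA u; have ui : dom i u := chart_atP M (tpoint u).
have y0 : tvector u i <> 0 by exact: (slitP ui).1.
set x := @coord _ _ _ A i (tpoint u).
set l := L \o @param _ _ _ TA i.
have d0 (v : 'rV[R]_n) : v <> 0 -> 'd l (x, 0) (0, v) = l (x, v).
  move=> v0.
  have c : {for (x, 0), continuous (fun z => 'd l z (0, v))}.
    apply: ((C1 i).2 (0, v)).
    have [wi wK] := @fibre_paramK i (tpoint u) 0 ui.
    by exists (@param _ _ _ TA i (x, 0)).
  have c1 : (x, t *: v) @[t --> (0 : R)] --> (x, 0 : 'rV[R]_n).
    have c0 : t *: v @[t --> (0 : R)] --> (0 : 'rV[R]_n).
      by rewrite -[X in _ --> X](scale0r v); apply: cvgZr_tmp; exact: cvg_id.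
    exact: (cvg_pair (@cvg_cst _ x _ _ _) c0).
  have c2 : 'd l (x, t *: v) (0, v) @[t --> (0 : R)] --> 'd l (x, 0) (0, v).
    exact: (cvg_comp (fun t : R => (x, t *: v)) (fun z => 'd l z (0, v)) c1 c).
  have c3 : 'd l (x, t *: v) (0, v) @[t --> 0^'+] --> 'd l (x, 0) (0, v).
    exact: cvg_at_right_filter c2.
  have c4 : 'd l (x, t *: v) (0, v) @[t --> 0^'+] --> l (x, v).
    apply: (@cvg_trans _ ((cst (l (x, v)) : R -> R) @ 0^'+)); last exact: cvg_cst.
    apply: near_eq_cvg; near=> t; rewrite /= finsler_ray //.
  exact: (cvg_unique _ c3 c4).
have pos (v : 'rV[R]_n) : v <> 0 -> 0 < 'd l (x, 0) (0, v).
  by move=> v0; rewrite d0 //; apply: finsler_gt0 => //; exact: fibre_slit.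
have := pos (- tvector u i).
have -> : (0, - tvector u i) = - (0, tvector u i) :> 'rV[R]_n * 'rV[R]_n.
  exact: (f_equal2 pair (esym (oppr0 _)) erefl).
rewrite linearN oppr_gt0 => /(_ _)/lt_trans/(_ (pos _ y0)).
rewrite ltxx => /(_ _)/notF; apply; apply/eqP; rewrite oppr_eq0; exact/eqP.
Unshelve. all: by end_near. Qed.

End Dimension.
End Fibres.

(** * Proportional vertical differentials force conformality *)
Section Backward.
Variables (R : realType) (n : nat) (M : manifold R n).
Local Notation TM := (tangent_bundle M).
Local Notation TA := (natural_atlas M).
Local Notation A := (matlas M).
Variables (L L' : TM -> R) (hL : finsler L) (hL' : finsler L').
Hypothesis dJE : forall u : TM, slit u ->
  forall X : tvec TA u, dJ L' X / L' u = dJ L X / L u.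
Implicit Types (u : TM) (i : idx TA) (p : M).

Lemma vertical_dlog i u (v : 'rV[R]_n) : dom i u -> slit u ->
  'd (L' \o param i) (coord i u) (0, v) / L' u =
  'd (L \o param i) (coord i u) (0, v) / L u.
Proof.
move=> ui us; have [X XE] := exists_tangent_comp (v, 0) ui.
(* J X only sees the horizontal components of X, which can be prescribed. *)
have dJc (K : TM -> R) : finsler K ->
    dJ K X = 'd (K \o param i) (coord i u) (0, v).
  move=> hK; rewrite /dJ (finsler_tdiffE hK _ ui us).
  by rewrite /= /push_comp XE.
by rewrite -(dJc _ hL') -(dJc _ hL); exact: dJE.
Qed.

Definition ratio u := L' u / L u.

(** L'/L has zero derivative along a line of a punctured fibre. *)
Lemma ratio_line i p (a w : 'rV[R]_n) : @dom _ _ _ A i p ->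
  (forall t : R, a + t *: (w - a) <> 0) ->
  ratio (@param _ _ _ TA i (@coord _ _ _ A i p, a)) =
  ratio (@param _ _ _ TA i (@coord _ _ _ A i p, w)).
Proof.
move=> pi aw; set x := @coord _ _ _ A i p.
pose g (t : R) := (x, a) + t *: (0, w - a) : 'rV[R]_n * 'rV[R]_n.
have gE t : g t = (x, a + t *: (w - a)).
  have e1 : x + t *: 0 = x by rewrite scaler0 addr0.
  exact: (f_equal2 pair e1 erefl).
pose u t := @param _ _ _ TA i (g t).
have us t : slit (u t) by rewrite /u gE; exact: fibre_slit.
have ui t : dom i (u t) by rewrite /u gE; exact: (fibre_paramK _ pi).1.
have uK t : coord i (u t) = g t by rewrite /u gE; exact: (fibre_paramK _ pi).2.
pose f := (fun t : R => (L' \o @param _ _ _ TA i) (g t)) *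
          (fun t : R => ((L \o @param _ _ _ TA i) (g t))^-1).
have l0 t : L (u t) != 0 by rewrite gt_eqF // finsler_gt0.
have l0' t : L' (u t) != 0 by rewrite gt_eqF // finsler_gt0.
have line (K : TM -> R) (t : R) : finsler K ->
    is_derive t 1 (fun s : R => (K \o @param _ _ _ TA i) (g s))
      ('d (K \o @param _ _ _ TA i) (g t) (0, w - a)).
  move=> hK; apply: is_derive_line; rewrite -[X in differentiable _ X]uK.
  exact: finsler_diff.
have f' (t : R) : is_derive t 1 f 0.
  have D1 := line L' t hL'; have D2 := is_deriveV (l0 t) (line L t hL).
  apply: (is_derive_eq (is_deriveM D1 D2)).
  have := vertical_dlog (w - a) (ui t) (us t); rewrite uK.
  set d' := 'd _ _ _; set d := 'd _ _ _ => E.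
  change (L' (u t) * (- L (u t) ^- 2 * d) + (L (u t))^-1 * d' = 0).
  have {}E : d' = L' (u t) * (d / L (u t)) by rewrite -E mulrCA mulfV // mulr1.
  by rewrite E; field; exact: l0.
have := @is_derive_0_is_cst _ f 0 1 f'.
have fE t : f t = ratio (u t) by [].
by rewrite !fE /u !gE scale0r scale1r addr0 [a + _]addrC subrK.
Qed.

(** Independent vectors are joined by a line missing the origin; dependent ones
    are compared through a third vector outside their common span, which exists
    since n >= 2. *)
Lemma ratio_fibre p (X Y : tvec A p) :
  slit (existT _ p X) -> slit (existT _ p Y) ->
  ratio (existT _ p X) = ratio (existT _ p Y).
Proof.
move=> Xs Ys; have n2 := finsler_dim_ge2 hL Xs.
set i : idx TA := chart_at A p; have pi : @dom _ _ _ A i p := chart_atP M p.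
have X0 : X i <> 0 by exact: (slitP (u := existT _ p X) pi).1.
have Y0 : Y i <> 0 by exact: (slitP (u := existT _ p Y) pi).1.
have XK : @param _ _ _ TA i (@coord _ _ _ A i p, X i) = existT _ p X.
  exact: (@natural_coordK _ _ M i (existT _ p X) pi).
have YK : @param _ _ _ TA i (@coord _ _ _ A i p, Y i) = existT _ p Y.
  exact: (@natural_coordK _ _ M i (existT _ p Y) pi).
rewrite -XK -YK.
have [[k kE]|XY] := pselect (exists k : R, Y i = k *: X i); last first.
  apply: ratio_line => //; apply: noncollinear_line => // k e; apply: XY.
  by exists k.
have [w wX] := exists_noncollinear (X i) n2.
rewrite (ratio_line (w := w) pi); last exact: noncollinear_line.
apply/esym/ratio_line => //; apply: noncollinear_line => // m e.
by apply: (wX (m * k)); rewrite -scalerA -kE.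
Qed.

Lemma differentiable_ratio_fibre i p (y : 'rV[R]_n) :
  @dom _ _ _ A i p -> y <> 0 ->
  differentiable (fun x : 'rV[R]_n => ratio (@param _ _ _ TA i (x, y)))
    (@coord _ _ _ A i p).
Proof.
move=> pi y0; set x0 := @coord _ _ _ A i p.
have [ui uK] := fibre_paramK y pi; have us := fibre_slit pi y0.
have dinc : differentiable (fun x : 'rV[R]_n => (x, y)) x0.
  have d1 : differentiable id x0 by exact: ex_diff.
  have d2 : differentiable (fun=> y) x0 by exact: differentiable_cst.
  exact: (differentiable_pair d1 d2).
have d (K : TM -> R) : finsler K ->
    differentiable (fun x : 'rV[R]_n => K (@param _ _ _ TA i (x, y))) x0.
  move=> hK; have := finsler_diff hK ui us; rewrite uK => dK.
  exact: (differentiable_comp dinc dK).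
apply: differentiableM; first exact: d.
apply: differentiableV; first exact: d.
by rewrite gt_eqF // finsler_gt0.
Qed.

(** An arbitrary choice of a nonzero vector at each point; it need not vary
    continuously, as L'/L only depends on the point. *)
Definition base_vector p : TM :=
  existT _ p (tvec_of_comp (chart_at A p) p (const_mx 1)).

(** The factor psi is (L'/L)^2 evaluated on [base_vector].  Its differentiability
    is checked on the vectors with components (1, ..., 1) in a fixed chart,
    which give the same value by [ratio_fibre]. *)
Lemma dJ_conformal : conformal L L'.
Proof.
have [[u0 us0]|nos] := pselect (exists u : TM, slit u); last first.
  (* no nonzero vectors: the condition on the metrics is vacuous *)
  exists (fun=> 1); split=> [u|i u ui _|X Y [u us]] //.
    exact: differentiable_cst.
  by case: nos; exists u.
have n2 := finsler_dim_ge2 hL us0.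
have y1 : (const_mx 1 : 'rV[R]_n) <> 0.
  case: (n) n2 => // m _ /(congr1 (fun v : 'rV[R]_m.+1 => v 0 ord0)) /eqP.
  by rewrite !mxE oner_eq0.
have s1 p : slit (base_vector p) by exact: slit_param (chart_atP M p) y1.
have ratio_gt0 u : slit u -> 0 < ratio u.
  by move=> us; rewrite divr_gt0 // finsler_gt0.
pose phi p := ratio (base_vector p) ^+ 2.
(* also valid on the zero section, where both energies vanish *)
have energyE u : L' u ^+ 2 = phi (tpoint u) * L u ^+ 2.
  have [us|us] := pselect (slit u); last first.
    by rewrite (finsler_off_slit hL us) (finsler_off_slit hL' us) expr0n mulr0.
  have -> : phi (tpoint u) = ratio u ^+ 2.
    case: u us => p X us; rewrite /phi; congr (_ ^+ 2); exact: ratio_fibre (s1 p) us.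
  by rewrite -exprMn divfK // gt_eqF // finsler_gt0.
exists (fun u => phi (tpoint u)); split=> [u|i u ui _|X Y [u us]].
- by rewrite exprn_gt0 // ratio_gt0.
- set p := tpoint u in ui *.
  pose h (x : 'rV[R]_n) := ratio (@param _ _ _ TA i (x, const_mx 1)) ^+ 2.
  have dh : differentiable h (@coord _ _ _ A i p).
    rewrite (_ : h = (fun x => ratio (@param _ _ _ TA i (x, const_mx 1))) ^+ 2).
      by apply: differentiableX; have := differentiable_ratio_fibre (i := i) (p := p) ui y1.
    by apply/funext => x; rewrite exprfctE.
  have [dfst _] := is_diff_fst (@coord _ _ _ TA i u).
  have dhf : differentiable (h \o fst) (@coord _ _ _ TA i u).
    exact: differentiable_comp.
  have e : \forall z \near @coord _ _ _ TA i u,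
      (h \o fst) z = ((fun u => phi (tpoint u)) \o @param _ _ _ TA i) z.
    apply: filterS (dom_near (u := u) ui) => z [zi _] /=; congr (_ ^+ 2).
    by exact: (ratio_fibre (slit_param zi y1) (s1 _)).
  by have [] := near_eq_is_diff e dhf.
rewrite /metric /= mulr_sumr; apply: eq_bigr => i _.
rewrite mulr_sumr; apply: eq_bigr => j _.
by rewrite (metric_comp_scale hL us energyE i j) -!mulrA.
Qed.

End Backward.

Theorem theorem4p5 (R : realType) (n : nat) (M : manifold R n)
    (L L' : tangent_bundle M -> R) (hL : finsler L) (hL' : finsler L') :
  conformal L L' <->
  (forall u : tangent_bundle M, slit u ->
     forall X : tvec (natural_atlas M) u, dJ L' X / L' u = dJ L X / L u).
Proof. by split; [exact: conformal_dJ|exact: dJ_conformal]. Qed.
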